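(* For each $C>0$, there exists a classical abstract Swiss cheese $B=((b_n,s_n))_{n=0}^\infty$ such that $R(X_B)$ has no non-zero bounded point derivations, $s_0=1$, the unit circle $\mathbb{T}=\{z\in\mathbb{C}:|z|=1\}$ satisfies $\mathbb{T}\subseteq X_B$, and $$\sum_{n=1}^\infty \frac{s_n}{d_n^2}\leq C,$$ where, for each $n\geq 1$, $d_n$ is the distance from the disk $\mathrm{B}(b_n,s_n)$ to $\mathbb{T}$ if $s_n>0$, and $d_n=1$ if $s_n=0$.
   Context: Notation: $\mathbb{R}^+$ denotes the set of non-negative real numbers, $\mathbb{N}$ the set of positive integers, and $\mathbb{N}_0$ the set of non-negative integers. For $a\in\mathbb{C}$ and $r>0$, $\mathrm{B}(a,r)$ is the open disk in $\mathbb{C}$ with centre $a$ and radius $r$, and $\bar{\mathrm{B}}(a,r)$ is the corresponding closed disk; also $\mathrm{B}(a,0)=\emptyset$ and $\bar{\mathrm{B}}(a,0)=\{a\}$. An abstract Swiss cheese is a sequence $A=((a_n,r_n))_{n=0}^\infty\in(\mathbb{C}\times\mathbb{R}^+)^{\mathbb{N}_0}$. Its significant index set is $S_A:=\{n\in\mathbb{N}: r_n>0\}$. Its associated Swiss cheese set is $$X_A:=\bar{\mathrm{B}}(a_0,r_0)\setminus\bigcup_{n=1}^\infty \mathrm{B}(a_n,r_n).$$ The abstract Swiss cheese $A$ is classical if $\sum_{n=1}^\infty r_n<\infty$, $r_0>0$, and for all $k\in S_A$ the following hold: (a) $\bar{\mathrm{B}}(a_k,r_k)\subseteq \mathrm{B}(a_0,r_0)$;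 (b) whenever $\ell\in S_A$ with $\ell\neq k$, we have $\bar{\mathrm{B}}(a_k,r_k)\cap \bar{\mathrm{B}}(a_\ell,r_\ell)=\emptyset$. For a non-empty compact set $X\subseteq\mathbb{C}$, $C(X)$ is the algebra of continuous complex-valued functions on $X$ with the uniform norm $|f|_X=\sup_{x\in X}|f(x)|$, $R_0(X)$ is the set of (restrictions to $X$ of) rational functions with poles off $X$, and $R(X)$ is the closure of $R_0(X)$ in $C(X)$. For a commutative unital Banach algebra $A$ and a character $\varphi$ on $A$, a point derivation at $\varphi$ is a linear functional $d$ on $A$ such that $d(ab)=\varphi(a)d(b)+d(a)\varphi(b)$ for all $a,b\in A$; it is bounded if it is continuous. The characters on $R(X)$ are exactly the point evaluations $f\mapsto f(x)$ for $x\in X$. ''$R(X)$ has no non-zero bounded point derivations'' means that for every character $\varphi$ on $R(X)$, every bounded point derivation at $\varphi$ is zero. *)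

(* Defs.v *)
From HB Require Import structures.
From mathcomp Require Import all_boot all_order all_algebra.
From mathcomp Require Import complex.
From mathcomp Require Import all_classical all_reals all_analysis.

Set Implicit Arguments.
Unset Strict Implicit.
Unset Printing Implicit Defensive.

Import Order.TTheory GRing.Theory Num.Theory.
Import numFieldNormedType.Exports.

Local Open Scope classical_set_scope.
Local Open Scope ring_scope.
Local Open Scope complex_scope.

(* R[i] has no topology of its own in the libraries: give it the one of the
   normed module R[i]^o, i.e. the usual topology induced by the modulus. *)
HB.instance Definition _ (R : realType) := NormedModule.copy R[i] R[i]^o.

Section Disks.
Variable R : realType.
Implicit Types (a z w : R[i]) (r : R) (A B : set R[i]).

Definition cmod z : R := ComplexField.Normc.normc z.

(* For r = 0 these are respectively empty and {a}, whereas the library's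
   [closed_ball a 0], the closure of an open ball, is empty. *)
Definition open_disk a r : set R[i] := [set z | cmod (z - a) < r].
Definition closed_disk a r : set R[i] := [set z | cmod (z - a) <= r].

Definition unit_circle : set R[i] := [set z | cmod z = 1].

Definition set_dist A B : R := inf [set cmod (z - w) | z in A & w in B].

End Disks.
Arguments unit_circle : clear implicits.

Section SwissCheese.
Variable R : realType.

Definition abstract_swiss_cheese : Type := nat -> R[i] * {nonneg R}.

Implicit Type A : abstract_swiss_cheese.

Definition disk_center A n : R[i] := (A n).1.
Definition disk_radius A n : R := (A n).2%:num.

Definition significant A : set nat :=
  [set n | (1 <= n)%N /\ 0 < disk_radius A n].

Definition swiss_cheese_set A : set R[i] :=
  closed_disk (disk_center A 0) (disk_radius A 0) `\`
  \bigcup_(n in [set n | (1 <= n)%N])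
    open_disk (disk_center A n) (disk_radius A n).

Definition classical_swiss_cheese A : Prop :=
  [/\ (\sum_(1 <= n <oo) (disk_radius A n)%:E < +oo)%E,
      0 < disk_radius A 0,
      forall k, significant A k ->
        closed_disk (disk_center A k) (disk_radius A k) `<=`
        open_disk (disk_center A 0) (disk_radius A 0)
    & forall k l, significant A k -> significant A l -> l <> k ->
        closed_disk (disk_center A k) (disk_radius A k) `&`
        closed_disk (disk_center A l) (disk_radius A l) = set0].

Definition dist_to_unit_circle A n : R :=
  if 0 < disk_radius A n
  then set_dist (open_disk (disk_center A n) (disk_radius A n)) (unit_circle R)
  else 1.

End SwissCheese.

Section RationalFunctions.
Variables (R : realType) (X : set R[i]).

(* The functions on X carry the topology of uniform convergence on X, which is
   the topology of the uniform norm on its subspace C(X) when X is compact. *)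

Definition C_of : set {uniform X -> R[i]} :=
  [set f | continuous (f : X -> R[i])].

Definition R0_of : set {uniform X -> R[i]} :=
  [set f | exists p q : {poly R[i]},
     (forall x, X x -> q.[x] != 0) /\
     f = (fun x : X => p.[\val x] / q.[\val x])].

Definition R_of : set {uniform X -> R[i]} := C_of `&` closure R0_of.

End RationalFunctions.
Arguments C_of {R} X.
Arguments R0_of {R} X.
Arguments R_of {R} X.

(* Let A be a set of functions closed under the pointwise algebra operations.
   A functional on A is represented by one on all functions, of which only the
   values on A matter. *)
Section PointDerivations.
Variables (R : realType) (T : choiceType) (A : set {uniform T -> R[i]}).
Implicit Types phi d : {uniform T -> R[i]} -> R[i].

Definition linear_functional d : Prop :=
  forall (c : R[i]) (f g : T -> R[i]), A f -> A g ->
    d (c *: f + g) = c * d f + d g.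

Definition character phi : Prop :=
  [/\ linear_functional phi,
      forall f g : T -> R[i], A f -> A g -> phi (f * g) = phi f * phi g
    & exists2 f, A f & phi f != 0].

Definition point_derivation phi d : Prop :=
  linear_functional d /\
  forall f g : T -> R[i], A f -> A g ->
    d (f * g) = phi f * d g + d f * phi g.

Definition bounded_point_derivation phi d : Prop :=
  point_derivation phi d /\ {within A, continuous d}.

Definition no_nonzero_bounded_point_derivation : Prop :=
  forall phi d, character phi -> bounded_point_derivation phi d ->
    forall f, A f -> d f = 0.

End PointDerivations.

(* Main.v *)
Require Import Defs.
From mathcomp Require Import all_boot all_order all_algebra.
From mathcomp Require Import complex ring lra zify.
From mathcomp Require Import all_classical all_reals all_analysis.

Import Order.TTheory GRing.Theory Num.Theory.
Import numFieldNormedType.Exports.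

Local Open Scope classical_set_scope.
Local Open Scope ring_scope.

Set Implicit Arguments.
Unset Strict Implicit.
Unset Printing Implicit Defensive.

(** Let X be the closed unit disk with countably many small open disks removed.
    A bounded point derivation d at a character phi of R(X) is determined by
    d(Z), where Z is the coordinate function: phi is evaluation at the point
    a = phi(Z) of X, hence d(f) = f'(a) d(Z) for every rational f with poles off
    X.  So d vanishes as soon as X carries rational functions bounded by a
    common constant whose derivatives at a are arbitrarily large
    ([bpd_X_eq0], [bpd_eq0]).

    When |a| = 1 the powers of Z do this.  When |a| < 1 one uses sums of simple
    poles.  Suppose that disks of radius r = tau/N^2 have been removed around
    the points of a square grid of mesh 2/N.  Put
      f(z) = sum_b c_b r / (z - b),   |c_b| = 1,
    where b runs over the L x L box of grid points next to a.  Each term is at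
    most 1 on X, and away from its own grid point it is at most 2/N; so f is
    bounded by 1 + 2L^2/N, which is at most 2 once N is large compared with L^2
    ([sum_le_one_large]).  With the best phases c_b, however,
      |f'(a)| = sum_b r / |a - b|^2 >= (tau/4) sum_(p,q < L) 1/(p + q + 3)^2,
    and this double sum grows like log L ([double_sum_unbounded]).  So L is
    chosen first, to make (tau/4) times the double sum at least k, and then N is
    chosen much larger; the total radius of such a stage is at most
    N^2 r = tau, which may be prescribed as small as wanted.

    The construction superposes such stages k = 0, 1, 2, ...  Stage k only uses
    grid points with |b| <= 1 - 1/(k+2), so that its disks stay at distance at
    least 1/(2(k+2)) from the unit circle, and tau_k is so small that the
    contribution of stage k to the weighted sum is at most C/2^(k+1).

    The disks must also have disjoint closures.  A grid disk is therefore
    removed only if its closure misses all disks removed at earlier stages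
    ([greedy_selection]).  When it is skipped, an earlier disk, which is at
    least as large, is so close that moving the pole by 2r puts it inside that
    disk at depth r ([push_into_disk]).  Every grid point thus has a pole nearby
    at distance at least r from X, and the estimates above hold unchanged
    ([grid_unbounded_pole_sums]). *)

(** * The modulus *)
Arguments cmod : simpl never.

Section Modulus.
Context {R : realType}.
Implicit Types z w : R[i].

Lemma cmodE z : `|z| = (cmod z)%:C%C.
Proof. by rewrite normc_def; case: z. Qed.

Lemma cmod_ge0 z : 0 <= cmod z.
Proof. by case: z => x y; rewrite /cmod /= sqrtr_ge0. Qed.

Lemma cmod0 : cmod (0 : R[i]) = 0. Proof. exact: ComplexField.Normc.normc0. Qed.
Lemma cmod1 : cmod (1 : R[i]) = 1. Proof. exact: ComplexField.Normc.normc1. Qed.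

Lemma cmod_eq0 z : (cmod z == 0) = (z == 0).
Proof.
apply/eqP/eqP => [/ComplexField.Normc.eq0_normc //|->]; exact: cmod0.
Qed.

Lemma cmodM z w : cmod (z * w) = cmod z * cmod w.
Proof. exact: ComplexField.Normc.normcM. Qed.

Lemma cmodV z : cmod z^-1 = (cmod z)^-1.
Proof. exact: ComplexField.Normc.normcV. Qed.

Lemma cmodX z n : cmod (z ^+ n) = cmod z ^+ n.
Proof. by elim: n => [|n IH]; rewrite ?expr0 ?cmod1// !exprS cmodM IH. Qed.

Lemma cmodN z : cmod (- z) = cmod z.
Proof.
by case: z => x y; rewrite /cmod /= !sqrrN.
Qed.

Lemma cmodBC z w : cmod (z - w) = cmod (w - z).
Proof. by rewrite -cmodN opprB. Qed.

Lemma cmodD z w : cmod (z + w) <= cmod z + cmod w.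
Proof. exact: le_normcD. Qed.

Lemma cmodB3 u z w : cmod (z - w) <= cmod (z - u) + cmod (u - w).
Proof. by rewrite (_ : z - w = (z - u) + (u - w)) ?cmodD//; ring. Qed.

Lemma cmod_real (x : R) : cmod x%:C%C = `|x|.
Proof. by rewrite /cmod /= expr0n /= addr0 sqrtr_sqr. Qed.

Lemma cmod_nat n : cmod (n%:R : R[i]) = n%:R.
Proof.
by rewrite (_ : n%:R = (n%:R : R)%:C%C) ?cmod_real ?ger0_norm// rmorph_nat.
Qed.

Lemma cmod_sum (I : Type) (r : seq I) (P : pred I) (F : I -> R[i]) :
  cmod (\sum_(i <- r | P i) F i) <= \sum_(i <- r | P i) cmod (F i).
Proof.
elim/big_ind2 : _ => [|a x b y ha hb|//]; first by rewrite cmod0.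
exact: le_trans (cmodD _ _) (lerD ha hb).
Qed.

Lemma normRe_le_cmod z : `|complex.Re z| <= cmod z.
Proof.
case: z => x y; rewrite /cmod /= -sqrtr_sqr ler_wsqrtr//.
by rewrite lerDl sqr_ge0.
Qed.

Lemma normIm_le_cmod z : `|complex.Im z| <= cmod z.
Proof.
case: z => x y; rewrite /cmod /= -sqrtr_sqr ler_wsqrtr//.
by rewrite lerDr sqr_ge0.
Qed.

Lemma cmod_le_ReIm z : cmod z <= `|complex.Re z| + `|complex.Im z|.
Proof.
case: z => x y; have -> : (x +i* y = x%:C + 0 +i* y)%C.
  by apply/eqP; rewrite eq_complex /= addr0 add0r !eqxx.
apply: le_trans (cmodD _ _) _; rewrite cmod_real.
by rewrite /cmod /= expr0n /= add0r sqrtr_sqr addr0 add0r.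
Qed.

End Modulus.

(** * Rational functions on X *)

Lemma horner_continuous {K : numFieldType} (p : {poly K}) :
  continuous (fun z : K => p.[z]).
Proof.
elim/poly_ind: p => [|p c IH] x.
  by rewrite (_ : (fun z => _) = cst 0);
    [exact: cst_continuous|apply/funext => z; rewrite horner0].
rewrite (_ : (fun z => _) = (fun z => p.[z]) \* idfun + cst c);
  last by apply/funext => z; rewrite hornerMXaddC.
apply: continuousD; last exact: cst_continuous.
by apply: continuousM; [exact: IH|move=> t].
Qed.

Section RationalFunctions.
Context {R : realType} (X : set R[i]).
Local Notation A := (R_of X).

Definition ratf (p q : {poly R[i]}) : {uniform X -> R[i]} :=
  fun x : X => p.[\val x] / q.[\val x].

Lemma ratf_R0 (p q : {poly R[i]}) :
  (forall x, X x -> q.[x] != 0) -> R0_of X (ratf p q).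
Proof. by move=> hq; exists p, q. Qed.

Lemma R0_sub_R : R0_of X `<=` A.
Proof.
move=> f Hf; split; last exact: subset_closure.
case: Hf => p [q [hq ->]] x.
have hv : {for x, continuous (\val : X -> R[i])} by exact: initial_continuous.
have cp (s : {poly R[i]}) : {for x, continuous (fun x : X => s.[\val x])}.
  apply: (continuous_comp hv); exact: (@horner_continuous (R[i])).
apply: (@continuousM (R[i]) X _ _ _ (cp p)).
apply: (@continuousV (R[i]) X _ _ _ (cp q)).
apply: hq; exact: set_valP.
Qed.

Lemma ratf_R (p q : {poly R[i]}) :
  (forall x, X x -> q.[x] != 0) -> A (ratf p q).
Proof. by move=> hq; apply/R0_sub_R/ratf_R0. Qed.

Lemma R0_scale c f : R0_of X f -> R0_of X (c *: f).
Proof.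
case=> p [q [hq ->]]; exists (c *: p), q; split=> //.
by apply/funext => x; rewrite !fctE hornerZ -mulrA.
Qed.

Lemma R0_add f g : R0_of X f -> R0_of X g -> R0_of X (f + g).
Proof.
case=> p [q [hq ->]] [p' [q' [hq' ->]]].
exists (p * q' + p' * q), (q * q'); split=> [x Xx|].
  by rewrite hornerM mulf_neq0 ?hq ?hq'.
apply/funext => x; rewrite !fctE hornerD !hornerM addf_div//.
  by apply: hq; exact: set_valP.
by apply: hq'; exact: set_valP.
Qed.

End RationalFunctions.

(** * Point derivations on rational functions *)

Section PointDerivation.
Context {R : realType} (X : set R[i]).
Local Notation A := (R_of X).
Variables phi d : {uniform X -> R[i]} -> R[i].
Hypotheses (phi_char : character A phi) (d_der : point_derivation A phi d).

Local Notation ratf := (@ratf R X).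

Definition polyf (p : {poly R[i]}) : {uniform X -> R[i]} :=
  fun x : X => p.[\val x].

Lemma polyfE p : polyf p = ratf p 1.
Proof. by apply/funext => x; rewrite /ratf /polyf hornerC divr1. Qed.

Lemma polyf_R p : A (polyf p).
Proof. by rewrite polyfE; apply: ratf_R => x _; rewrite hornerC oner_neq0. Qed.

#[local] Hint Resolve polyf_R : core.

Lemma charM f g : A f -> A g -> phi (f * g) = phi f * phi g.
Proof. by case: phi_char => _ + _; exact. Qed.

Lemma linear_functional0 (l : {uniform X -> R[i]} -> R[i]) : linear_functional A l -> l (polyf 0) = 0.
Proof.
move=> hl; have := hl (-1) _ _ (polyf_R 0) (polyf_R 0).
rewrite (_ : -1 *: polyf 0 + polyf 0 = polyf 0) ?mulN1r ?addNr//.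
by rewrite scaleN1r addNr; apply/funext => x; rewrite /polyf horner0.
Qed.

Lemma linear_functionalZ (l : {uniform X -> R[i]} -> R[i]) c f : linear_functional A l ->
  A f -> l (c *: f) = c * l f.
Proof.
move=> hl Af; have := hl c _ _ Af (polyf_R 0).
rewrite linear_functional0// addr0 => <-; congr l.
by apply/funext => x; rewrite !fctE /polyf horner0 addr0.
Qed.

Lemma char1 : phi (polyf 1) = 1.
Proof.
case: (phi_char) => _ hM [f Af nz]; apply: (mulfI nz).
rewrite mulr1 -charM//; congr phi.
by apply/funext => x; rewrite !fctE /polyf hornerC mulr1.
Qed.

Lemma polyfM p q : polyf p * polyf q = polyf (p * q).
Proof. by apply/funext => x; rewrite /polyf !fctE hornerM. Qed.

Lemma der1 : d (polyf 1) = 0.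
Proof.
case: d_der => _ /(_ _ _ (polyf_R 1) (polyf_R 1)).
rewrite polyfM mulr1 char1 mul1r mulr1 => /eqP.
by rewrite -subr_eq0 opprD addrA subrr sub0r oppr_eq0 => /eqP.
Qed.

Local Notation a := (phi (polyf 'X)).
Local Notation dZ := (d (polyf 'X)).

Lemma polyf_MXaddC p c : polyf (p * 'X + c%:P) = c *: polyf 1 + polyf p * polyf 'X.
Proof.
apply/funext => x; rewrite /polyf !fctE !hornerE addrC.
by rewrite /GRing.scale /= mulr1.
Qed.

Lemma char_polyf p : phi (polyf p) = p.[a].
Proof.
case: phi_char => hl hM _; elim/poly_ind: p => [|p c IH].
  by rewrite linear_functional0// horner0.
rewrite polyf_MXaddC hl ?polyfM// char1 -polyfM charM// IH.
by rewrite hornerMXaddC mulr1 addrC.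
Qed.

Lemma der_polyf p : d (polyf p) = p^`().[a] * dZ.
Proof.
case: d_der => hl hM; elim/poly_ind: p => [|p c IH].
  by rewrite linear_functional0// deriv0 horner0 mul0r.
rewrite polyf_MXaddC hl ?polyfM// der1 -polyfM hM// IH.
rewrite (char_polyf p) derivMXaddC hornerD hornerMX mulr0 add0r.
ring.
Qed.

(** If [a] were off X, then [Z - a] would be invertible in R(X) although [phi]
    kills it. *)
Lemma char_X_in : X a.
Proof.
apply: contrapT => nXa.
have hq x : X x -> ('X - a%:P).[x] != 0.
  by move=> Xx; rewrite hornerXsubC subr_eq0; apply: contra_notN nXa => /eqP <-.
have := charM (polyf_R ('X - a%:P)) (ratf_R 1 hq).
rewrite (char_polyf ('X - a%:P)) hornerXsubC subrr mul0r => /eqP.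
rewrite (_ : _ * _ = polyf 1) ?char1 ?oner_eq0//.
apply/funext => x; rewrite /polyf /ratf !fctE hornerC mul1r divff//.
apply: hq; exact: set_valP.
Qed.

(** The quotient rule, obtained by applying [d] to [(p / q) * q = p]. *)
Lemma der_ratf p q : (forall x, X x -> q.[x] != 0) ->
  d (ratf p q) = (p^`().[a] * q.[a] - p.[a] * q^`().[a]) / q.[a] ^+ 2 * dZ.
Proof.
move=> hq; have qa : q.[a] != 0 by apply: hq; exact: char_X_in.
have E : ratf p q * polyf q = polyf p.
  apply/funext => x; rewrite /polyf /ratf !fctE divfK//.
  apply: hq; exact: set_valP.
have := charM (ratf_R p hq) (polyf_R q); rewrite E (char_polyf p) (char_polyf q) => Ephi.
case: d_der => _ /(_ _ _ (ratf_R p hq) (polyf_R q)); rewrite E (der_polyf p) (der_polyf q) (char_polyf q) => Ed.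
apply: (mulIf qa); rewrite -[LHS](addKr (phi (ratf p q) * (q^`().[a] * dZ))) -Ed Ephi.
by field.
Qed.

Lemma der_pole b : ~ X b -> d (ratf 1 ('X - b%:P)) = - dZ / (a - b) ^+ 2.
Proof.
move=> Xb; rewrite der_ratf => [|x Xx].
  rewrite -[1]polyC1 derivC derivXsubC horner0 hornerXsubC polyC1 hornerC.
  by rewrite mul0r mulr1 sub0r mulrAC mulN1r.
by rewrite hornerXsubC subr_eq0; apply: contra_notN Xb => /eqP <-.
Qed.

End PointDerivation.

(** * Consequences of boundedness *)

Section BoundedPointDerivation.
Context {R : realType} (X : set R[i]).
Local Notation A := (R_of X).
Variables phi d : {uniform X -> R[i]} -> R[i].
Hypotheses (phi_char : character A phi) (d_bpd : bounded_point_derivation A phi d).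
Local Notation dZ := (d (@polyf R X 'X)).

(** Continuity within R(X) for the topology of uniform convergence, unfolded
    into epsilons. *)
Lemma bpd_local f e : A f -> 0 < e ->
  exists2 r : R, 0 < r & forall g, A g ->
    (forall x, cmod (f x - g x) < r) -> cmod (d f - d g) < e.
Proof.
move=> Af e0; case: d_bpd => _ /subspace_continuousP /(_ f Af) cd.
have e0C : 0 < e%:C%C by rewrite ltcR.
have /cd : nbhs (d f) (ball (d f) e%:C%C) by exact: nbhsx_ballx.
rewrite /= nbhs_simpl /= /within /=.
case/uniform_nbhs => E [].
rewrite -entourage_ballE => -[r /= r0 rE] EP.
have rR : r = (complex.Re r)%:C%C by rewrite RRe_real// gtr0_real.
exists (complex.Re r); first by rewrite -ltcR -rR.
move=> g Ag fg.
have /= := EP g _ Ag; rewrite -ball_normE /= cmodE ltcR; apply.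
move=> x _; apply: rE => /=; rewrite -ball_normE /= cmodE rR ltcR.
exact: fg.
Qed.

Lemma bpd_bounded : exists2 r : R, 0 < r & forall g, A g ->
  (forall x, cmod (g x) < r) -> cmod (d g) < 1.
Proof.
have [r r0 H] := bpd_local (@polyf_R R X 0) ltr01; exists r => // g Ag gr.
have [[hl _] _] := d_bpd.
have := H g Ag; rewrite (linear_functional0 hl) sub0r cmodN; apply => x.
by rewrite /polyf horner0 sub0r cmodN.
Qed.

(** A non-zero [d Z] would make the derivation unbounded: scaling the functions
    into the neighbourhood of 0 on which [d] is below 1 leaves derivatives above
    1. *)
Lemma bpd_X_eq0 (K : R) :
  (forall M : R, exists f, [/\ R0_of X f, forall x, cmod (f x) <= K
    & M * cmod dZ <= cmod (d f)]) -> dZ = 0.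
Proof.
move=> H; apply/eqP; rewrite -cmod_eq0; apply: contraT => dZ0.
have dZp : 0 < cmod dZ by rewrite lt_neqAle eq_sym dZ0 cmod_ge0.
have [[hl _] _] := d_bpd.
have [r r0 Hr] := bpd_bounded.
pose s : R := r / (`|K| + 1).
have K0 : 0 < `|K| + 1 by rewrite ltr_wpDl.
have s0 : 0 < s by rewrite divr_gt0.
have [f [Rf fK fd]] := H (s^-1 / cmod dZ).
have Asf := R0_sub_R (R0_scale s%:C%C Rf).
have := Hr _ Asf; rewrite (linear_functionalZ _ hl) ?cmodM//; last exact: R0_sub_R.
rewrite cmod_real gtr0_norm// => Hs.
suff: s * cmod (d f) < 1.
  rewrite ltNge => /negP[]; rewrite -(@mulfV _ s) ?gt_eqF// ler_pM2l//.
  by move: fd; rewrite divfK.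
apply: Hs => x; rewrite /GRing.scale /= cmodM cmod_real gtr0_norm//.
apply: le_lt_trans (ler_wpM2l (ltW s0) (fK x)) _.
rewrite /s mulrAC ltr_pdivrMr// ltr_pM2l//.
by rewrite (le_lt_trans (ler_norm K))// ltrDl.
Qed.

(** With [d Z = 0] the quotient rule kills all rational functions, and these are
    uniformly dense in R(X). *)
Lemma bpd_eq0 : dZ = 0 -> forall f, A f -> d f = 0.
Proof.
move=> dZ0 f Af; apply/eqP; rewrite -cmod_eq0; apply: contraT => df0.
have dfp : 0 < cmod (d f) by rewrite lt_neqAle eq_sym df0 cmod_ge0.
have [r r0 Hr] := bpd_local Af dfp.
have r0C : 0 < r%:C%C by rewrite ltcR.
have [_ /(_ [set g | forall x, cmod (f x - g x) < r])] := Af.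
case.
  apply/uniform_nbhs.
  exists [set xy | ball xy.1 r%:C%C xy.2]; split.
    by rewrite -entourage_ballE; exists r%:C%C.
  by move=> g /= Hg x; have := Hg x I; rewrite -ball_normE /= cmodE ltcR.
move=> g [Hg /Hr]; case: Hg (Hg) => p [q [hq ->]] Rg => /(_ (R0_sub_R Rg)).
rewrite -[fun x => _]/(ratf p q) (der_ratf phi_char d_bpd.1)// dZ0 mulr0 subr0.
by rewrite ltxx.
Qed.

End BoundedPointDerivation.

(** * A criterion for the absence of bounded point derivations *)

Section Criterion.
Context {R : realType} (X : set R[i]).
Local Notation A := (R_of X).

Lemma linear_sum_R0 (l : {uniform X -> R[i]} -> R[i]) (I : Type) (s : seq I)
    (c : I -> R[i]) (g : I -> {uniform X -> R[i]}) :
  linear_functional A l -> (forall i, R0_of X (g i)) ->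
  R0_of X (\sum_(i <- s) c i *: g i) /\
  l (\sum_(i <- s) c i *: g i) = \sum_(i <- s) c i * l (g i).
Proof.
move=> hl Rg; elim: s => [|i s [IR IH]].
  rewrite !big_nil; have := linear_functional0 hl.
  have -> : polyf 0 = (0 : {uniform X -> R[i]}).
    by apply/funext => x; rewrite /polyf horner0.
  split=> //; exists 0, 1; split=> [x _|]; first by rewrite hornerC oner_neq0.
  by apply/funext => x; rewrite horner0 mul0r.
rewrite !big_cons; split; first by apply: R0_add => //; exact: R0_scale.
by rewrite hl ?IH//; exact: R0_sub_R.
Qed.

(** These are the sup-norm bound and the derivative at [a] of the sums of simple
    poles [c_i * r / (z - b i)] with unimodular [c_i], the phases being chosen so
    that no cancellation occurs in the derivative. *)
Definition unbounded_pole_sums (a : R[i]) : Prop :=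
  forall M : R, exists (I : finType) (b : I -> R[i]) (r : R),
    [/\ 0 < r,
        forall i z, X z -> r <= cmod (z - b i),
        forall z, X z -> \sum_i r / cmod (z - b i) <= 2
      & M <= \sum_i r / cmod (a - b i) ^+ 2].

Variables phi d : {uniform X -> R[i]} -> R[i].
Hypotheses (phi_char : character A phi) (d_bpd : bounded_point_derivation A phi d).
Local Notation a := (phi (@polyf R X 'X)).
Local Notation dZ := (d (@polyf R X 'X)).

Lemma bpd_X_eq0_of_poles : unbounded_pole_sums a -> dZ = 0.
Proof.
move=> H; apply: (bpd_X_eq0 d_bpd (K := 2)) => M.
have Xa := char_X_in phi_char.
have [I [b [r [r0 rb b2 bM]]]] := H M.
have ab i : 0 < cmod (a - b i) by rewrite (lt_le_trans r0)// rb.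
have nXb i : ~ X (b i).
  by move=> /(rb i); rewrite subrr cmod0 leNgt r0.
have hq i x : X x -> ('X - (b i)%:P).[x] != 0.
  move=> Xx; rewrite hornerXsubC subr_eq0.
  by apply: contra_notN (nXb i) => /eqP <-.
(* The phase (a - b)^2 / |a - b|^2 makes each term of the derivative real and
   of the same sign. *)
pose c i : R[i] := r%:C%C * ((a - b i) ^+ 2 / (cmod (a - b i) ^+ 2)%:C%C).
pose g i : {uniform X -> R[i]} := ratf 1 ('X - (b i)%:P).
have Rg i : R0_of X (g i) by apply: ratf_R0; exact: hq.
have [[hl _] _] := d_bpd.
have [Rf df] := linear_sum_R0 (index_enum I) c hl Rg.
exists (\sum_i c i *: g i); split=> //.
- move=> x; apply: le_trans (b2 (\val x) (set_valP x)).
  rewrite fct_sumE; apply: le_trans (cmod_sum _ _ _) _.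
  rewrite le_eqVlt; apply/orP; left; apply/eqP; apply: eq_bigr => i _.
  rewrite !fctE /g /ratf hornerC hornerXsubC div1r cmodM cmodV /c.
  rewrite cmodM [cmod (_ / _)]cmodM cmodX cmodV !cmod_real normrX !ger0_norm ?cmod_ge0 ?(ltW r0)// divff ?mulr1//.
  by rewrite expf_neq0// gt_eqF.
- rewrite df (_ : \sum_i _ = (\sum_i r / cmod (a - b i) ^+ 2)%:C%C * - dZ).
    rewrite cmodM cmod_real cmodN ler_wpM2r ?cmod_ge0//.
    by rewrite (le_trans bM)// ler_norm.
  rewrite rmorph_sum /= mulr_suml; apply: eq_bigr => i _.
  rewrite /g (der_pole phi_char d_bpd.1)// /c !rmorphM /= fmorphV /=.
  have a0 : a - b i != 0 by rewrite -cmod_eq0 gt_eqF.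
  by field; rewrite a0 fmorph_eq0 gt_eqF.
Qed.

(** The powers of the coordinate function are bounded by 1 on X, while the
    derivative of ['X^n] at a point of modulus 1 has modulus n. *)
Lemma bpd_X_eq0_of_circle : (forall z, X z -> cmod z <= 1) -> cmod a = 1 -> dZ = 0.
Proof.
move=> X1 a1; apply: (bpd_X_eq0 d_bpd (K := 1)) => M.
have R0p (p : {poly R[i]}) : R0_of X (polyf p).
  by rewrite polyfE; apply: ratf_R0 => x _; rewrite hornerC oner_neq0.
exists (polyf ('X ^+ (Num.truncn `|M|).+1)); split=> //.
  move=> x; rewrite /polyf hornerXn cmodX exprn_ile1 ?cmod_ge0// X1//.
  exact: set_valP.
rewrite (der_polyf phi_char d_bpd.1 'X^_) derivXn hornerMn hornerXn cmodM.
rewrite ler_wpM2r ?cmod_ge0// -mulr_natr cmodM cmodX a1 expr1n mul1r cmod_nat.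
by rewrite (le_trans (ler_norm M))// ltW// truncnS_gt.
Qed.

End Criterion.

Lemma no_bpd_of_poles {R : realType} (X : set R[i]) :
  (forall z, X z -> cmod z <= 1) ->
  (forall a, X a -> cmod a < 1 -> unbounded_pole_sums X a) ->
  no_nonzero_bounded_point_derivation (R_of X).
Proof.
move=> X1 H phi d hphi hd; apply: (bpd_eq0 hphi hd).
have Xa := char_X_in hphi.
have := X1 _ Xa; rewrite le_eqVlt => /orP[/eqP|] a1.
  exact: bpd_X_eq0_of_circle hphi hd X1 a1.
exact: bpd_X_eq0_of_poles hphi hd (H _ Xa a1).
Qed.

(** * Three elementary tools *)

(** Decide membership rank by rank, rejecting an element exactly when it conflicts
    with one already kept at a lower rank. *)
Lemma greedy_selection (T : Type) (rank : T -> nat) (V : set T)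
    (conflict : T -> T -> Prop) :
  exists K : set T, [/\ K `<=` V,
    forall i j, K i -> K j -> (rank j < rank i)%N -> ~ conflict i j
    & forall i, V i ->
        K i \/ exists2 j, K j & (rank j < rank i)%N /\ conflict i j].
Proof.
(* [U k] collects the kept elements of rank below [k]. *)
pose U := fix U k : set T := if k is k'.+1 then
  U k' `|` [set i | [/\ V i, rank i = k' & forall j, U k' j -> ~ conflict i j]]
  else set0.
pose K := [set i | V i /\ forall j, U (rank i) j -> ~ conflict i j].
have UK k i : U k i <-> (rank i < k)%N /\ K i.
  elim: k => [|k IH] /=; first by split=> // -[].
  split=> [[/IH[ik Ki]|[Vi <- Ui]]|[]].
  - by split=> //; exact: ltnW.
  - by split.
  - rewrite ltnS leq_eqVlt => /orP[/eqP <-|ik] Ki; last by left; apply/IH.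
    by right; split=> //; case: Ki.
exists K; split=> [i []//|i j /= [_ Ki] Kj ji|i Vi].
  by apply: Ki; apply/UK.
have [Ki|] := pselect (K i); first by left.
move=> nKi; right; move: nKi.
apply: contra_notP => nex; split=> // j /UK[ji Kj] cij.
by apply: nex; exists j.
Qed.

(** If a disk meets a larger one, a translate of it by at most twice its radius
    lies inside the larger one: move the centre [c1] along the segment towards
    [c2] until its distance to [c2] is at most [r2 - r1]. *)
Lemma push_into_disk {R : realType} (c1 c2 : R[i]) (r1 r2 : R) :
  0 < r1 -> r1 <= r2 -> cmod (c1 - c2) <= r1 + r2 ->
  exists2 b, cmod (b - c1) <= 2 * r1 & cmod (b - c2) + r1 <= r2.
Proof.
move=> r10 r12 c12; have s0 : 0 < r1 + r2 by lra.
(* This ratio sends the greatest allowed distance r1 + r2 to r2 - r1. *)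
pose l : R := (r2 - r1) / (r1 + r2).
have l0 : 0 <= l by rewrite divr_ge0; lra.
have l1 : 0 <= 1 - l.
  by rewrite subr_ge0 ler_pdivrMr// mul1r; lra.
have ls : l * (r1 + r2) = r2 - r1 by rewrite divfK ?gt_eqF.
exists (c2 + l%:C%C * (c1 - c2)).
  rewrite (_ : _ - c1 = (1 - l)%:C%C * (c2 - c1)); last first.
    by rewrite rmorphB rmorph1; ring.
  rewrite cmodM cmod_real ger0_norm// cmodBC.
  apply: le_trans (ler_wpM2l l1 c12) _.
  by rewrite mulrBl ls; lra.
rewrite addrAC subrr add0r cmodM cmod_real ger0_norm//.
by move: (ler_wpM2l l0 c12); rewrite ls; lra.
Qed.

(** The terms with [q <= p] are at least [1/(2p + 3)^2], and there are [p + 1] of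
    them, so each [p] contributes at least a ninth of [1/(p + 1)]: the double sum
    dominates a multiple of the harmonic series. *)
Lemma double_sum_unbounded (R : realType) (M : R) : exists L : nat,
  M <= \sum_(i : 'I_L * 'I_L) ((i.1 + i.2 + 3)%:R ^+ 2)^-1.
Proof.
have [L hL] : exists L, 9 * M <= series (@harmonic R) L.
  apply: contrapT => H; apply: (@dvg_harmonic R).
  apply: nondecreasing_is_cvgn.
    apply/nondecreasing_seqP => n; rewrite /series /= big_nat_recr//= lerDl.
    exact: harmonic_ge0.
  exists (9 * M) => _ [L _ <-]; apply: ltW; rewrite ltNge; apply/negP => hL.
  by apply: H; exists L.
exists L; rewrite -(@ler_pM2l _ 9)//; apply: le_trans hL _.
rewrite -(pair_bigA _ (fun p q : 'I_L => ((p + q + 3)%:R ^+ 2)^-1 : R)) /=.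
rewrite mulr_sumr seriesEord; apply: ler_sum => p _ /=.
rewrite (bigID (fun q : 'I_L => (q <= p)%N)) /=.
apply: (@le_trans _ _ (9 * \sum_(q < L | (q <= p)%N) ((2 * p + 3)%:R ^+ 2)^-1)).
  rewrite -(big_ord_widen L (fun=> ((2 * p + 3)%:R ^+ 2)^-1 : R) (ltn_ord p)).
  rewrite sumr_const card_ord.
  rewrite -[_ ^- 2 *+ _]mulr_natl mulrA ler_pdivlMr; last first.
    by rewrite exprn_gt0// ltr0n addnC.
  rewrite mulrC ler_pdivrMr ?ltr0n// -natrX -!natrM ler_nat.
  nia.
rewrite ler_pM2l// -[leLHS]addr0; apply: lerD; last first.
  by apply: sumr_ge0 => q _; rewrite invr_ge0 exprn_ge0.
apply: ler_sum => q qp; rewrite lef_pV2 ?posrE ?exprn_gt0 ?ltr0n ?addn3//.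
by rewrite lerXn2r ?nnegrE// ler_nat; lia.
Qed.

(** * The grid disks *)

Section Grid.
Context {R : realType}.
Variables (tau : nat -> R) (N : nat -> nat).

(** [(k, (u, v))] is the grid point with coordinates [u], [v] of stage [k]. *)
Definition grid_index : Type := (nat * (nat * nat))%type.
Implicit Types i j : grid_index.

(** Stage [k] has mesh [2 / N k]: its grid points with both coordinates below
    [N k] spread over the square of side 2 around the unit disk. *)
Definition grid_center i : R[i] :=
  Complex (2 * i.2.1%:R / (N i.1)%:R - 1) (2 * i.2.2%:R / (N i.1)%:R - 1).

(** With at most [(N k)^2] disks per stage, [tau k] bounds the total radius of
    stage [k]. *)
Definition grid_radius k : R := tau k / (N k)%:R ^+ 2.

(** The last condition keeps the disks of a stage at a definite distance from the
    unit circle, while every point of the open unit disk is eventually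
    surrounded by admissible grid points. *)
Definition grid_domain : set grid_index :=
  [set i | [/\ (i.2.1 < N i.1)%N, (i.2.2 < N i.1)%N
             & cmod (grid_center i) + (i.1.+2)%:R^-1 <= 1]].

Hypothesis tau_gt0 : forall k, 0 < tau k.
Hypothesis tau_le1 : forall k, tau k <= 1.
Hypothesis tau_noninc : forall k l, (k <= l)%N -> tau l <= tau k.
Hypothesis N_nondec : forall k l, (k <= l)%N -> (N k <= N l)%N.
Hypothesis N_large : forall k, (4 * k.+2 <= N k)%N.

Lemma N_gt0 k : 0 < (N k)%:R :> R.
Proof. by rewrite ltr0n (leq_trans _ (N_large k)). Qed.

Lemma grid_radius_gt0 k : 0 < grid_radius k.
Proof. by rewrite divr_gt0// exprn_gt0// N_gt0. Qed.

Lemma grid_radius_noninc k l : (k <= l)%N -> grid_radius l <= grid_radius k.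
Proof.
move=> kl; apply: ler_pM; rewrite ?tau_noninc// ?invr_ge0 ?exprn_ge0 ?(ltW (tau_gt0 l))//.
by rewrite lef_pV2 ?posrE ?exprn_gt0 ?N_gt0// lerXn2r ?nnegrE// ler_nat N_nondec.
Qed.

Lemma grid_radius_small k : grid_radius k <= (8 * (N k)%:R)^-1 /\ grid_radius k <= (2 * k.+2%:R)^-1.
Proof.
have N0 := N_gt0 k.
have N8 : 8 <= (N k)%:R :> R.
  by rewrite ler_nat (leq_trans _ (N_large k)); lia.
have NL : 4 * k.+2%:R <= (N k)%:R :> R.
  by rewrite -natrM ler_nat.
have k0 : 0 < k.+2%:R :> R by rewrite ltr0n.
have H1 : grid_radius k <= (8 * (N k)%:R)^-1.
  rewrite ler_pdivrMr ?exprn_gt0// mulrC ler_pdivlMr ?mulr_gt0//.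
  have := tau_le1 k; have := tau_gt0 k; nra.
split=> //; apply: le_trans H1 _.
rewrite lef_pV2 ?posrE ?mulr_gt0//; nra.
Qed.

Lemma grid_sep i j : i.1 = j.1 -> i <> j ->
  2 / (N i.1)%:R <= cmod (grid_center i - grid_center j).
Proof.
case: i => k [u v]; case: j => l [u' v'] /= <-{l} ne; have N0 := N_gt0 k.
have key (x y : nat) : x <> y ->
    2 / (N k)%:R <= `|(2 * x%:R / (N k)%:R - 1) - (2 * y%:R / (N k)%:R - 1) : R|.
  move=> xy; rewrite (_ : _ - _ = 2 / (N k)%:R * (x%:R - y%:R)); last by ring.
  rewrite normrM ger0_norm ?divr_ge0 ?(ltW N0)// ler_peMr ?divr_ge0 ?(ltW N0)//.
  have [lt|lt|//] := ltngtP x y.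
    rewrite distrC -natrB ?(ltnW lt)// ger0_norm// ler1n; lia.
  rewrite -natrB ?(ltnW lt)// ger0_norm// ler1n; lia.
have [uu|/eqP uu] := eqVneq u u'; last first.
  by apply: le_trans (normRe_le_cmod _); exact: key.
have [vv|/eqP vv] := eqVneq v v'; last first.
  by apply: le_trans (normIm_le_cmod _); exact: key.
by case: ne; rewrite uu vv.
Qed.

(** The set [K] of removed disks: they are pairwise separated, and yet every grid
    point of the domain, kept or not, has a pole [b] nearby whose disk of the
    same radius lies in a removed disk.  For a skipped grid point the removed
    disk comes from an earlier stage, hence is at least as large, which is what
    [push_into_disk] asks for. *)
Lemma grid_disks :
  exists K : set grid_index, [/\ K `<=` grid_domain,
    forall i j, K i -> K j -> i <> j ->
      grid_radius i.1 + grid_radius j.1 < cmod (grid_center i - grid_center j)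
    & forall i, grid_domain i -> exists2 b,
        cmod (b - grid_center i) <= 2 * grid_radius i.1 &
        exists2 j, K j & cmod (b - grid_center j) + grid_radius i.1 <= grid_radius j.1].
Proof.
pose conf i j := cmod (grid_center i - grid_center j) <= grid_radius i.1 + grid_radius j.1.
have [K [KD Ksep Kmax]] := greedy_selection fst grid_domain conf.
exists K; split=> //.
- move=> i j Ki Kj ij; rewrite ltNge; apply/negP => cij.
  have [lt|lt|eq] := ltngtP i.1 j.1.
  + by apply: (Ksep j i) => //; rewrite /conf cmodBC [leRHS]addrC.
  + exact: (Ksep i j).
  + move: cij; rewrite -eq leNgt; apply/negP/negPn.
    apply: lt_le_trans (grid_sep eq ij).
    have [H _] := grid_radius_small i.1; have N0 := N_gt0 i.1.
    apply: le_lt_trans (lerD H H) _.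
    rewrite invfM -mulrDl ltr_pM2r ?invr_gt0//; lra.
- move=> i Di; have r0 := grid_radius_gt0 i.1.
  have [Ki|[j Kj [ji cij]]] := Kmax i Di.
    exists (grid_center i); first by rewrite subrr cmod0 mulr_ge0// ltW.
    by exists i => //; rewrite subrr cmod0 add0r.
  have [b b1 b2] := push_into_disk r0 (grid_radius_noninc (ltnW ji)) cij.
  by exists b => //; exists j.
Qed.

End Grid.

(** * Large derivatives from a grid box *)

(** A family of numbers at most 1 of which at most one exceeds [e]; applied to the
    moduli of the simple poles, only one of which can be close to a given
    point. *)
Lemma sum_le_one_large {R : realDomainType} (I : finType) (F : I -> R) (e : R) :
  0 <= e -> (forall i, F i <= 1) ->
  (forall i j, e < F i -> e < F j -> i = j) ->
  \sum_i F i <= 1 + #|I|%:R * e.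
Proof.
move=> e0 F1 Funiq.
have small (P : pred I) : (forall i, P i -> F i <= e) ->
    \sum_(i | P i) F i <= #|I|%:R * e.
  move=> H; apply: (@le_trans _ _ (\sum_(i | P i) e)); first exact: ler_sum.
  rewrite sumr_const -[leLHS]mulr_natl ler_wpM2r// ler_nat; exact: max_card.
have [[i0 hi0]|none] := pselect (exists i, e < F i).
  rewrite (bigD1 i0)//= lerD// small// => i ii0.
  rewrite leNgt; apply: contra ii0 => hi; apply/eqP; exact: Funiq.
rewrite -[leLHS]add0r lerD// small// => i _; rewrite leNgt; apply/negP => hi.
by apply: none; exists i.
Qed.

Section GridPoles.
Context {R : realType}.
Variables (tau : nat -> R) (N L : nat -> nat) (X : set R[i]).
Local Notation r := (grid_radius tau N).
Local Notation c := (@grid_center R N).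

Hypothesis tau_gt0 : forall k, 0 < tau k.
Hypothesis tau_le1 : forall k, tau k <= 1.
Hypothesis N_large : forall k, (4 * k.+2 * (L k).+1 ^ 2 <= N k)%N.
Hypothesis L_large : forall k,
  k%:R <= tau k / 4 * \sum_(i : 'I_(L k) * 'I_(L k)) ((i.1 + i.2 + 3)%:R ^+ 2)^-1.
Hypothesis X_poles : forall i, @grid_domain R N i -> exists2 b,
  cmod (b - c i) <= 2 * r i.1 & forall z, X z -> r i.1 <= cmod (z - b).

Lemma N_ge_linear k : (4 * k.+2 <= N k)%N.
Proof. by apply: leq_trans (N_large k); rewrite leq_pmulr// expn_gt0. Qed.

(** Truncation, plus one so that the grid points lie on the far side of [x]. *)
Lemma grid_coord k (x : R) : -1 <= x ->
  exists u : nat, forall p : nat,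
    0 <= 2 * (u + p)%:R / (N k)%:R - 1 - x <= 2 / (N k)%:R * p.+1%:R.
Proof.
move=> x1; have N0 := @N_gt0 R _ N_ge_linear k.
pose e : R := 2 / (N k)%:R; have e0 : 0 < e by rewrite divr_gt0.
have xe : 0 <= (x + 1) / e by rewrite divr_ge0 ?(ltW e0)//; lra.
exists (Num.truncn ((x + 1) / e)).+1 => p.
have /andP[] := truncn_itv xe.
rewrite ler_pdivlMr// ltr_pdivrMr//; set u := Num.truncn _ => h1 h2.
rewrite (_ : 2 * _ / _ = (u.+1 + p)%:R * e); last by rewrite /e; ring.
rewrite -/e natrD mulrDl -[p.+1]addn1 natrD mulrDr.
have : 0 <= p%:R * e by rewrite mulr_ge0// ltW.
move: h1 h2; rewrite -[in u.+1%:R]natr1 mulrDl !mul1r mulr1.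
by rewrite (mulrC e p%:R) => h1 h2 h3; apply/andP; split; lra.
Qed.

(** Near a point [a] well inside the disk, the [L k] x [L k] box of grid points to
    the upper right of [a] lies in the domain of stage [k], since its diameter is
    of order [L k / N k]. *)
Lemma grid_box k (a : R[i]) : cmod a + 2 / k.+2%:R <= 1 ->
  exists f : 'I_(L k) * 'I_(L k) -> nat * nat, injective f /\ forall i,
    @grid_domain R N (k, f i) /\
    cmod (c (k, f i) - a) <= 2 / (N k)%:R * (i.1 + i.2 + 2)%:R.
Proof.
move=> ak; have N0 := @N_gt0 R _ N_ge_linear k.
have k0 : 0 < 2 / k.+2%:R :> R by rewrite divr_gt0.
have a1 : cmod a < 1 by apply: lt_le_trans ak; rewrite ltrDl.
have ra : -1 <= complex.Re a.
  have := normRe_le_cmod a; rewrite ler_norml => /andP[]; lra.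
have ia : -1 <= complex.Im a.
  have := normIm_le_cmod a; rewrite ler_norml => /andP[]; lra.
have [u hu] := grid_coord k ra; have [v hv] := grid_coord k ia.
exists (fun i : 'I_(L k) * 'I_(L k) => (u + i.1, v + i.2)%N); split.
  by move=> [p q] [p' q'] /= [/addnI/val_inj -> /addnI/val_inj ->].
move=> [p q] /=; set i := (k, _).
have ci : cmod (c i - a) <= 2 / (N k)%:R * (p + q + 2)%:R.
  apply: le_trans (cmod_le_ReIm _) _.
  have -> : complex.Re (c i - a) = 2 * (u + p)%:R / (N k)%:R - 1 - complex.Re a.
    by case: (a).
  have -> : complex.Im (c i - a) = 2 * (v + q)%:R / (N k)%:R - 1 - complex.Im a.
    by case: (a).
  have /andP[u0 u1] := hu p; have /andP[v0 v1] := hv q.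
  rewrite !ger0_norm//; apply: le_trans (lerD u1 v1) _.
  by rewrite -mulrDr -natrD addSn addnS addn2.
split=> //.
have small : 2 / (N k)%:R * (p + q + 2)%:R <= k.+2%:R^-1 :> R.
  rewrite mulrAC ler_pdivrMr// ler_pdivlMl ?ltr0n// -!natrM ler_nat.
  apply: leq_trans (N_large k); have := ltn_ord p; have := ltn_ord q.
  move: (p : nat) (q : nat) => p' q' ? ?; nia.
have cc : cmod (c i) + k.+2%:R^-1 <= 1.
  have := cmodD (c i - a) a; rewrite subrK.
  move: (le_trans ci small) ak; generalize (k.+2%:R^-1 : R) => s; lra.
have lt1 : cmod (c i) < 1.
  by apply: lt_le_trans cc; rewrite ltrDl invr_gt0 ltr0n.
have inN (w : nat) : 2 * w%:R / (N k)%:R - 1 < 1 :> R -> (w < N k)%N.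
  rewrite ltrBlDr ltr_pdivrMr// => h; rewrite -(@ltr_nat R); lra.
split=> //=; apply: inN; apply: le_lt_trans lt1.
- apply: le_trans (normRe_le_cmod _); exact: ler_norm.
- apply: le_trans (normIm_le_cmod _); exact: ler_norm.
Qed.

(** Given [M], use a stage [k >= M] so late that [a] has distance at least
    [2 / (k + 2)] from the circle.  The poles attached to the box of grid points
    at [a] are then more than half a mesh apart, which bounds their sum on X by
    2, while [L_large] bounds the derivative below by [k]. *)
Lemma grid_unbounded_pole_sums a : X a -> cmod a < 1 -> unbounded_pole_sums X a.
Proof.
move=> Xa a1 M.
pose k := (Num.truncn (`|M| + 2 / (1 - cmod a))).+1.
have a0 : 0 < 1 - cmod a by rewrite subr_gt0.
have hk : `|M| + 2 / (1 - cmod a) < k%:R by rewrite truncnS_gt.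
have Mk : M <= k%:R.
  have := ler_norm M; have : 0 <= 2 / (1 - cmod a) by rewrite divr_ge0// ltW.
  lra.
have ak : cmod a + 2 / k.+2%:R <= 1.
  rewrite addrC -lerBrDr ler_pdivrMr ?ltr0n// mulrC -ler_pdivrMr//.
  have : k%:R <= k.+2%:R :> R by rewrite ler_nat; lia.
  have := normr_ge0 M; lra.
have [f [finj fP]] := grid_box ak.
have [b bP] := @choice _ _ (fun i b => cmod (b - c (k, f i)) <= 2 * r k /\
    forall z, X z -> r k <= cmod (z - b))
  (fun i => let: ex_intro2 b h1 h2 := X_poles (fP i).1 in ex_intro _ b (conj h1 h2)).
have r0 : 0 < r k := grid_radius_gt0 tau_gt0 N_ge_linear k.
have [r8 _] := grid_radius_small tau_gt0 tau_le1 N_ge_linear k.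
have N0 := @N_gt0 R _ N_ge_linear k.
pose h : R := (N k)%:R^-1; have h0 : 0 < h by rewrite invr_gt0.
have r8h : 8 * r k <= h.
  by move: r8; rewrite invfM -/h; lra.
have rh : r k = tau k * h ^+ 2 by rewrite /grid_radius exprVn.
have rz i z : X z -> 0 < cmod (z - b i).
  by move=> Xz; apply: lt_le_trans r0 _; exact: (bP i).2.
exists ('I_(L k) * 'I_(L k))%type, b, (r k); split=> //.
- by move=> i z; exact: (bP i).2.
- move=> z Xz.
  apply: le_trans (@sum_le_one_large _ _ _ (2 * h) _ _ _) _.
  + by rewrite mulr_ge0// ltW.
  + by move=> i; rewrite ler_pdivrMr ?rz// mul1r; exact: (bP i).2.
  (* A term above 2h = 2 / N k forces its pole within a quarter of the mesh,
     since r <= h^2; two such poles would have grid points closer than a mesh. *)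
  + have close i : 2 * h < r k / cmod (z - b i) -> cmod (z - b i) < h / 2.
      rewrite ltr_pdivlMr ?rz// => hz; have := tau_le1 k; have := tau_gt0 k.
      move: hz; rewrite rh; move: (cmod _) => x; nra.
    move=> i j /close zi /close zj; apply: finj; apply: contrapT => fij.
    have ij : (k, f i) <> (k, f j) by case.
    have := @grid_sep R N N_ge_linear (k, f i) (k, f j) erefl ij.
    rewrite [(k, f i).1]/= -/h.
    have := cmodB3 (b i) (c (k, f i)) (c (k, f j)).
    have := cmodB3 (b j) (b i) (c (k, f j)).
    have := cmodB3 z (b i) (b j).
    rewrite (cmodBC _ (b i)) (cmodBC (b i) z).
    have := (bP i).1; have := (bP j).1; lra.
  + rewrite card_prod card_ord [leRHS](_ : 2 = 1 + 1)// lerD2l.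
    rewrite /h mulrA ler_pdivrMr// mul1r -natrM ler_nat; apply: leq_trans (N_large k); nia.
- apply: le_trans Mk _; apply: le_trans (L_large k) _.
  rewrite mulr_sumr; apply: ler_sum => i _.
  have abi : cmod (a - b i) <= 2 * h * (i.1 + i.2 + 3)%:R.
    rewrite -[3%N]/(2 + 1)%N addnA natrD.
    have := cmodB3 (c (k, f i)) a (b i).
    rewrite (cmodBC a (c _)) (cmodBC (c _) (b i)).
    have := (fP i).2; have := (bP i).1; rewrite -/h.
    set m : R := (_ + 2)%:R; clearbody m; lra.
  rewrite ler_pdivlMr; last by rewrite exprn_gt0// rz.
  have d0 : 0 < (i.1 + i.2 + 3)%:R :> R by rewrite ltr0n addn3.
  apply: (@le_trans _ _ (tau k / 4 * ((i.1 + i.2 + 3)%:R ^+ 2)^-1 *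
      (2 * h * (i.1 + i.2 + 3)%:R) ^+ 2)).
    apply: ler_wpM2l.
      by rewrite !mulr_ge0 ?invr_ge0 ?exprn_ge0 ?(ltW (tau_gt0 k)).
    by rewrite lerXn2r ?nnegrE ?cmod_ge0// !mulr_ge0// ltW.
  rewrite rh le_eqVlt; apply/orP; left; apply/eqP.
  by field; rewrite gt_eqF.
Qed.

End GridPoles.

(** * The Swiss cheese cut out by the kept disks *)

Section GridSums.
Context {R : realType}.
Variables (N : nat -> nat) (W : nat -> R) (D : R) (w : grid_index -> R).
Hypothesis w_ge0 : forall i, 0 <= w i.
Hypothesis w_le : forall i,
  w i <= if (i.2.1 < N i.1)%N && (i.2.2 < N i.1)%N then W i.1 else 0.
Hypothesis W_ge0 : forall k, 0 <= W k.
Hypothesis stage_le : forall k, (N k)%:R ^+ 2 * W k <= D / 2 ^+ k.+1.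

(** Only the [N k ^ 2] grid points of stage [k] contribute, so the number of terms
    is bounded by counting. *)
Lemma stage_sum_le (s : seq grid_index) k : uniq s ->
  \sum_(i <- s | i.1 == k) w i <= D / 2 ^+ k.+1.
Proof.
move=> us; apply: le_trans (stage_le k).
apply: (@le_trans _ _ (\sum_(i <- s | i.1 == k)
   if (i.2.1 < N i.1)%N && (i.2.2 < N i.1)%N then W i.1 else 0)).
  by apply: ler_sum => i _; exact: w_le.
rewrite -big_mkcondr /=.
rewrite (eq_bigr (fun=> W k)); last by move=> i /andP[/eqP ->].
rewrite big_const_seq iter_addr_0 -[leLHS]mulr_natl ler_wpM2r// -natrX ler_nat.
rewrite -size_filter.
pose box := [seq (k, uv) | uv <- [seq (u, v) | u <- iota 0 (N k), v <- iota 0 (N k)]].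
apply: (@leq_trans (size box)); last first.
  by rewrite size_map size_allpairs size_iota.
apply: uniq_leq_size; first exact: filter_uniq.
case=> l [u v]; rewrite mem_filter /= => /andP[/andP[/eqP -> /andP[uN vN]] _].
apply: map_f; apply/allpairsP; exists (u, v); rewrite !mem_iota; split=> //.
Qed.

(** Adding the stages one by one, the bounds [D / 2^(k+1)] sum up to
    [D * (1 - 1/2^k)]. *)
Lemma grid_sum_le (s : seq grid_index) : uniq s -> 0 <= D -> \sum_(i <- s) w i <= D.
Proof.
move=> us D0.
have H k : \sum_(i <- s | (i.1 < k)%N) w i <= D * (1 - (2 ^+ k)^-1).
  elim: k => [|k IH].
    by rewrite big_pred0 ?expr0 ?invr1 ?subrr ?mulr0// => i; rewrite ltn0.
  rewrite (bigID (fun i : grid_index => (i.1 < k)%N)) /=.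
  rewrite (eq_bigl (fun i => (i.1 < k)%N)); last first.
    by move=> i; rewrite andb_idl// => /ltnW.
  rewrite [X in _ + X](eq_bigl (fun i => i.1 == k)); last first.
    by move=> i; rewrite -leqNgt ltnS -eqn_leq.
  apply: le_trans (lerD IH (stage_sum_le k us)) _.
  rewrite le_eqVlt; apply/orP; left; apply/eqP; rewrite exprS.
  by field; rewrite expf_neq0.
pose k := (\max_(i <- s) i.1).+1.
rewrite big_seq (eq_bigl (fun i => (i \in s) && (i.1 < k)%N)); last first.
  move=> i; case: (boolP (i \in s)) => //= si; symmetry; rewrite ltnS.
  exact: (@leq_bigmax_seq _ s xpredT (fun i => i.1)).
rewrite -big_seq_cond; apply: le_trans (H k) _.
by rewrite -[leRHS]mulr1 ler_wpM2l// gerBl invr_ge0 exprn_ge0.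
Qed.

(** The disks are enumerated through the countable type of indices.  Distinct
    places in the enumeration hold distinct indices, so every partial sum is
    dominated by a sum over a duplicate-free list. *)
Lemma grid_series_le (u : nat -> R) : 0 <= D ->
  (forall n, (0 < n)%N -> 0 <= u n <= oapp w 0 (pickle_inv n.-1)) ->
  (\sum_(1 <= n <oo) (u n)%:E <= D%:E)%E.
Proof.
move=> D0 uw; apply: lime_le.
  by apply: is_cvg_nneseries => n n0 _; rewrite lee_fin; case/andP: (uw n n0).
apply: nearW => m; rewrite sumEFin lee_fin.
case: m => [|m]; first by rewrite big_geq.
rewrite big_add1 /= big_mkord.
apply: (@le_trans _ _ (\sum_(n < m) oapp w 0 (pickle_inv n))).
  by apply: ler_sum => n _; case/andP: (uw n.+1 isT).
rewrite -(big_mkord xpredT (fun n => oapp w 0 (pickle_inv n))).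
rewrite -big_pmap; apply: grid_sum_le => //.
exact: (pmap_uniq pickle_invK (iota_uniq _ _)).
Qed.

End GridSums.

Section GridCheese.
Context {R : realType}.
Variables (tau : nat -> R) (N : nat -> nat) (K : set grid_index).
Hypothesis tau_gt0 : forall k, 0 < tau k.
Hypothesis tau_le1 : forall k, tau k <= 1.
Hypothesis N_large : forall k, (4 * k.+2 <= N k)%N.
Hypothesis K_dom : K `<=` @grid_domain R N.
Hypothesis K_sep : forall i j, K i -> K j -> i <> j ->
  grid_radius tau N i.1 + grid_radius tau N j.1 < cmod (@grid_center R N i - grid_center N j).

Definition kept_radius (i : grid_index) : R :=
  if `[< K i >] then grid_radius tau N i.1 else 0.

Lemma kept_radius_ge0 o : 0 <= oapp kept_radius 0 o.
Proof.
case: o => //= i; rewrite /kept_radius; case: ifP => // _.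
exact: ltW (grid_radius_gt0 tau_gt0 N_large _).
Qed.

(** Place [m + 1] holds the disk of the index encoded by [m]; codes of no index and
    indices outside [K] get radius 0 and remove nothing. *)
Definition grid_cheese : abstract_swiss_cheese R := fun n =>
  if n is m.+1
  then (oapp (@grid_center R N) 0 (pickle_inv m),
        NngNum (kept_radius_ge0 (pickle_inv m)))
  else (0, NngNum ler01).

Lemma grid_cheese_radius0 : disk_radius grid_cheese 0 = 1.
Proof. by []. Qed.

Lemma grid_cheese_radius n : (0 < n)%N ->
  disk_radius grid_cheese n = oapp kept_radius 0 (pickle_inv n.-1).
Proof. by case: n. Qed.

Lemma significantP n : significant grid_cheese n -> exists2 i, K i &
  [/\ n.-1 = pickle i, pickle_inv n.-1 = Some i,
      disk_center grid_cheese n = grid_center N i &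
      disk_radius grid_cheese n = grid_radius tau N i.1].
Proof.
case: n => [[]//|m [_]]; rewrite grid_cheese_radius//= /disk_center /=.
have := pickle_invK (T := grid_index) m.
case: (pickle_inv m) => [i|] /=; last by rewrite ltxx.
rewrite /kept_radius; case: asboolP => [Ki mi _|_ _]; last by rewrite ltxx.
by exists i.
Qed.

(** Half of the margin [1 / (k + 2)] required in [grid_domain] is left after
    allowing for the radius. *)
Lemma kept_in_disk i : K i ->
  cmod (@grid_center R N i) + grid_radius tau N i.1 + (2 * (i.1.+2)%:R)^-1 <= 1.
Proof.
move=> /K_dom[_ _ H].
have [_ r2] := grid_radius_small tau_gt0 tau_le1 N_large i.1.
have k0 : (i.1.+2)%:R != 0 :> R by rewrite pnatr_eq0.
have : (i.1.+2)%:R^-1 = (2 * (i.1.+2)%:R)^-1 + (2 * (i.1.+2)%:R)^-1 :> R by field.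
move: H r2; set y := (2 * _)^-1; set x := _.+2%:R^-1; clearbody x y; lra.
Qed.

Lemma kept_margin_gt0 (k : nat) : 0 < (2 * k.+2%:R)^-1 :> R.
Proof. by rewrite invr_gt0 mulr_gt0// ltr0n. Qed.

Lemma grid_cheese_classical :
  (\sum_(1 <= n <oo) (disk_radius grid_cheese n)%:E < +oo)%E ->
  classical_swiss_cheese grid_cheese.
Proof.
move=> sfin; split=> // [k sk|k l sk sl lk].
  have [i Ki [_ _ -> ->]] := significantP sk.
  move=> z; rewrite /closed_disk /open_disk /= subr0 grid_cheese_radius0 => zi.
  have := kept_in_disk Ki; have := kept_margin_gt0 i.1.
  have := cmodD (z - grid_center N i) (grid_center N i); rewrite subrK.
  set y := (2 * _)^-1; clearbody y; lra.
have [i Ki [ki _ -> ->]] := significantP sk.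
have [j Kj [lj _ -> ->]] := significantP sl.
have ij : i <> j.
  move=> ij; apply: lk; rewrite ij -lj in ki.
  by case: sk sl => k0 _ [l0 _]; rewrite -(prednK k0) -(prednK l0) ki.
rewrite -subset0 => z [] /=; rewrite /closed_disk /= => zi zj.
have := K_sep Ki Kj ij; have := cmodB3 z (grid_center N i) (grid_center N j).
rewrite (cmodBC _ z); lra.
Qed.

Lemma grid_cheese_set z : swiss_cheese_set grid_cheese z <->
  cmod z <= 1 /\
  forall i, K i -> grid_radius tau N i.1 <= cmod (z - grid_center N i).
Proof.
rewrite /swiss_cheese_set /closed_disk /= subr0; split=> -[z1 H]; split=> //.
  move=> i Ki; rewrite leNgt; apply/negP => zi; apply: H.
  exists (pickle i).+1 => //; rewrite /open_disk /disk_center /disk_radius /=.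
  by rewrite pickleK_inv /= /kept_radius asboolT.
case=> n n0; have [rn|rn] := ltP 0 (disk_radius grid_cheese n).
  have [i Ki [_ _ -> ->]] := significantP (conj n0 rn).
  by rewrite /open_disk /= ltNge H.
rewrite /open_disk /= => zn.
by have := cmod_ge0 (z - disk_center grid_cheese n); rewrite leNgt (lt_le_trans zn).
Qed.

Lemma grid_cheese_circle : unit_circle R `<=` swiss_cheese_set grid_cheese.
Proof.
move=> z; rewrite /unit_circle /= => z1; apply/grid_cheese_set.
split=> [|i Ki]; first by rewrite z1.
have := kept_in_disk Ki; have := kept_margin_gt0 i.1.
have := cmodD (z - grid_center N i) (grid_center N i); rewrite subrK z1.
set y := (2 * _)^-1; clearbody y; lra.
Qed.

(** [grid_domain] leaves a margin [1 / (k + 2)] at the centre, and the radius is at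
    most half of it. *)
Lemma grid_cheese_dist n : significant grid_cheese n ->
  exists2 i, K i & pickle_inv n.-1 = Some i /\
    (2 * (i.1.+2)%:R)^-1 <= dist_to_unit_circle grid_cheese n.
Proof.
move=> sn; have [i Ki [_ ni cn rn]] := significantP sn.
exists i => //; split=> //; rewrite /dist_to_unit_circle; case: sn => _ ->.
rewrite cn rn; apply: lb_le_inf.
  exists (cmod (grid_center N i - 1)); exists (grid_center N i).
    by rewrite /open_disk /= subrr cmod0 (grid_radius_gt0 tau_gt0 N_large).
  by exists 1 => //; rewrite /unit_circle /= cmod1.
move=> _ [z zi [u u1 <-]]; move: zi u1; rewrite /open_disk /unit_circle /= => zi u1.
have := kept_in_disk Ki.
have := cmodD (z - grid_center N i) (grid_center N i); rewrite subrK.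
have := cmodD (u - z) z; rewrite subrK u1 cmodBC.
set y := (2 * _)^-1; clearbody y; lra.
Qed.

End GridCheese.

(** * The theorem *)

Unset Implicit Arguments.

Theorem theorem8p3 (R : realType) (C : R) (hC : 0 < C) :
  exists B : abstract_swiss_cheese R,
    [/\ classical_swiss_cheese B,
        no_nonzero_bounded_point_derivation (R_of (swiss_cheese_set B)),
        disk_radius B 0 = 1,
        unit_circle R `<=` swiss_cheese_set B
      & (\sum_(1 <= n <oo) (disk_radius B n / dist_to_unit_circle B n ^+ 2)%:E
           <= C%:E)%E].
Proof.
pose m : R := Num.min 1 C.
have m0 : 0 < m by rewrite lt_min ltr01.
(* [(2 (k + 2))^2] is the weight [1 / d^2] of the disks of stage [k] at worst. *)
pose tau k : R := m / 2 ^+ k.+1 / (2 * k.+2%:R) ^+ 2.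
have q1 k : 1 <= (2 * k.+2%:R) ^+ 2 :> R.
  by rewrite exprn_ege1// -natrM ler1n.
have q0 k : 0 < (2 * k.+2%:R) ^+ 2 :> R by apply: lt_le_trans (q1 k).
have p0 k : 0 < 2 ^+ k :> R by rewrite exprn_gt0.
have tau_gt0 k : 0 < tau k by rewrite !divr_gt0.
have tau_weight k : tau k * (2 * k.+2%:R) ^+ 2 <= C / 2 ^+ k.+1.
  by rewrite divfK ?gt_eqF// ler_pM2r ?invr_gt0// ge_min lexx orbT.
have tau_noninc k l : (k <= l)%N -> tau l <= tau k.
  move=> kl; apply: ler_pM.
  - by rewrite ltW// divr_gt0.
  - by rewrite invr_ge0 ltW.
  - by rewrite ler_pM2l// lef_pV2 ?posrE// ler_eXn2l// ltr1n.
  - rewrite lef_pV2 ?posrE// lerXn2r ?nnegrE ?mulr_ge0//.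
    by rewrite ler_pM2l// ler_nat.
have tau_le1 k : tau k <= 1.
  rewrite ler_pdivrMr// mul1r (le_trans _ (q1 k))// ler_pdivrMr// mul1r.
  by rewrite (@le_trans _ _ 1) ?ge_min ?lexx// exprn_ege1// ler1n.
have [L hL] := @choice _ _ _ (fun k => double_sum_unbounded (k%:R / (tau k / 4))).
have L_large k : k%:R <= tau k / 4 * \sum_(i : 'I_(L k) * 'I_(L k))
    ((i.1 + i.2 + 3)%:R ^+ 2)^-1.
  by rewrite -ler_pdivrMl ?divr_gt0// mulrC.
(* Summing over the earlier stages makes [N] non-decreasing, so that the radii
   decrease from one stage to the next. *)
pose N k := (\sum_(l < k.+1) 4 * l.+2 * (L l).+1 ^ 2)%N.
have N_nondec k l : (k <= l)%N -> (N k <= N l)%N.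
  move=> kl; rewrite /N (big_ord_widen l.+1 (fun l => 4 * l.+2 * (L l).+1 ^ 2)%N)//.
  by rewrite big_mkcond leq_sum// => i _; case: ifP.
have N_large k : (4 * k.+2 * (L k).+1 ^ 2 <= N k)%N.
  by rewrite /N big_ord_recr leq_addl.
have N_large4 := N_ge_linear N_large.
have [K [K_dom K_sep K_pole]] :=
  @grid_disks R tau N tau_gt0 tau_le1 tau_noninc N_nondec N_large4.
pose B := grid_cheese K tau_gt0 N_large4.
have N0 k := @N_gt0 R N N_large4 k.
have radius_mass k : (N k)%:R ^+ 2 * grid_radius tau N k = tau k.
  by rewrite mulrC divfK// expf_neq0// gt_eqF.
have r0 k := grid_radius_gt0 tau_gt0 N_large4 k.
have kept0 i : 0 <= kept_radius tau N K i.
  exact: (kept_radius_ge0 K tau_gt0 N_large4 (Some i)).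
pose w (i : grid_index) := kept_radius tau N K i * (2 * i.1.+2%:R) ^+ 2.
have w0 i : 0 <= w i by rewrite mulr_ge0// ltW.
have w_sum u : (forall n, (0 < n)%N -> 0 <= u n <= oapp w 0 (pickle_inv n.-1)) ->
    (\sum_(1 <= n <oo) (u n)%:E <= C%:E)%E.
  apply: (@grid_series_le R N (fun k => grid_radius tau N k * (2 * k.+2%:R) ^+ 2) C w).
  - move=> i; rewrite /w /kept_radius; case: asboolP => [/K_dom[-> ->] //|_].
    by rewrite mul0r; case: ifP => // _; rewrite mulr_ge0// ltW.
  - by move=> k; rewrite mulr_ge0// ltW.
  - by move=> k; rewrite mulrA radius_mass.
  - exact: ltW.
have rad_le n : (0 < n)%N -> 0 <= disk_radius B n <= oapp w 0 (pickle_inv n.-1).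
  move=> n0; rewrite grid_cheese_radius// kept_radius_ge0 //=.
  case: (pickle_inv _) => //= i.
  by rewrite ler_peMr.
exists B; split.
- apply: grid_cheese_classical => //.
  apply: (@le_lt_trans _ _ C%:E); last exact: ltry.
  exact: w_sum.
- have XP := grid_cheese_set K tau_gt0 N_large4.
  apply: no_bpd_of_poles => [z /XP[]//|].
  apply: (grid_unbounded_pole_sums tau_gt0 tau_le1 N_large L_large) => i Di.
  have [b b1 [j Kj b2]] := K_pole i Di.
  exists b => // z /XP[_ /(_ j Kj)].
  have := cmodB3 b z (grid_center N j); lra.
- by [].
- exact: grid_cheese_circle.
- apply: w_sum => n n1; have /andP[rn0 _] := rad_le n n1.
  rewrite divr_ge0 ?sqr_ge0//=.
  have [rn|rn] := ltP 0 (disk_radius B n); last first.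
    rewrite (_ : disk_radius B n = 0) ?mul0r; last first.
      by apply: le_anti; rewrite rn.
    by case: (pickle_inv _) => /=.
  have [i Ki [ni di]] :=
    grid_cheese_dist tau_le1 K_dom (conj n1 rn).
  have y0 : 0 < 2 * i.1.+2%:R :> R by rewrite mulr_gt0// ltr0n.
  have d0 : 0 < dist_to_unit_circle B n by apply: lt_le_trans di; rewrite invr_gt0.
  rewrite grid_cheese_radius// ni /= /w ler_wpM2l// -exprVn.
  apply: lerXn2r; rewrite ?nnegrE ?invr_ge0 ?(ltW d0) ?(ltW y0)//.
  by rewrite -[leRHS]invrK lef_pV2 ?posrE ?invr_gt0.
Qed.
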